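(* Let $n\ge 2$. The expression $$d_V(z_1,\ldots,z_n)=\prod_{1\le j<i\le n}|z_i-z_j| = |V(z_1,\ldots,z_n)|,\qquad z_1,\ldots,z_n\in\mathbb{C},$$ defines an $n$-metric in $\mathbb{C}$ and, by restriction, also in $\mathbb{R}$.
   Context: Let $X$ be a set and $n\ge 2$. A map $d:X^n\to\mathbb{R}$ is a pseudo $n$-metric on $X$ if: (M1, semidefiniteness) if $x_i=x_j$ for some $i\ne j$, then $d(x_1,\ldots,x_n)=0$; (M2, symmetry) $d(x_{\pi(1)},\ldots,x_{\pi(n)})=d(x_1,\ldots,x_n)$ for all $x\in X^n$ and all permutations $\pi$ of $\{1,\ldots,n\}$; (M3, simplex inequality) $d(x_1,\ldots,x_n)\le\sum_{i=1}^n d(x_1,\ldots,x_{i-1},y,x_{i+1},\ldots,x_n)$ for all $x_1,\ldots,x_n,y\in X$. A pseudo $n$-metric is an $n$-metric if it is definite, i.e. $d(x_1,\ldots,x_n)=0$ implies $x_i=x_j$ for some $i\ne j$. $V(z_1,\ldots,z_n)$ denotes the Vandermonde determinant, i.e. the determinant of the $n\times n$ matrix whose $(k,j)$ entry is $z_j^{k-1}$; it equals $\prod_{1\le j<i\le n}(z_i-z_j)$. *)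

(* Defs.v *)
From mathcomp Require Import all_boot all_order all_fingroup all_algebra.
From mathcomp Require Import reals.
From mathcomp Require Export complex.

Set Implicit Arguments.
Unset Strict Implicit.
Unset Printing Implicit Defensive.

Import Order.TTheory GRing.Theory Num.Theory.

Local Open Scope ring_scope.
Local Open Scope complex_scope.

Definition replace_coord (n : nat) (X : Type) (x : {ffun 'I_n -> X})
    (i : 'I_n) (y : X) : {ffun 'I_n -> X} :=
  [ffun j => if j == i then y else x j].

(* Nonnegativity of [d] is not an axiom. *)
Record pseudo_nmetric (R : realType) (n : nat) (X : Type)
    (d : {ffun 'I_n -> X} -> R) : Prop := PseudoNMetric {
  nmetric_semidefinite : forall (x : {ffun 'I_n -> X}) (i j : 'I_n),
    i != j -> x i = x j -> d x = 0;
  nmetric_symmetry : forall (x : {ffun 'I_n -> X}) (s : 'S_n),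
    d [ffun i => x (s i)] = d x;
  nmetric_simplex : forall (x : {ffun 'I_n -> X}) (y : X),
    d x <= \sum_(i < n) d (replace_coord x i y)
}.

Record nmetric (R : realType) (n : nat) (X : Type)
    (d : {ffun 'I_n -> X} -> R) : Prop := NMetric {
  nmetric_pseudo : pseudo_nmetric d;
  nmetric_definite : forall x : {ffun 'I_n -> X},
    d x = 0 -> exists i j : 'I_n, i != j /\ x i = x j
}.

(* The reals are an arbitrary [R : realType] and the complex numbers are [R[i]].
   [Normc.normc] is the [R]-valued modulus; the generic [`|z|] on [R[i]] takes
   its values in [R[i]]. *)
Definition dV (R : realType) (n : nat) (z : {ffun 'I_n -> R[i]}) : R :=
  \prod_(i < n) \prod_(j < n | (j < i)%N) Normc.normc (z i - z j).

Definition vandermonde_det (R : realType) (n : nat) (z : {ffun 'I_n -> R[i]}) :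
    R[i] :=
  \det (Vandermonde n (\row_(j < n) z j)).

Definition dV_real (R : realType) (n : nat) (x : {ffun 'I_n -> R}) : R :=
  dV [ffun i => (x i)%:C].

(* Main.v *)
(** Replacing the i-th column of a matrix [A] by [u] gives a matrix whose
    determinant is the i-th entry of [\adj A *m u] (Cramer's rule).  When the
    first row of [A] consists of ones, summing these entries over i amounts to
    multiplying by that row, and [A *m \adj A = (\det A)%:M] turns the sum into
    [\det A] times the first entry of [u].  For a Vandermonde matrix and the
    column of powers of [y] that entry is 1, so V(x) is the sum over i of
    V(x with x_i replaced by y); the simplex inequality is the triangle
    inequality for the modulus applied to this identity. *)

Require Import Defs.
From mathcomp Require Import all_boot all_order all_algebra.
From mathcomp Require Import reals.
From mathcomp Require Import perm.

Set Implicit Arguments.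
Unset Strict Implicit.
Unset Printing Implicit Defensive.

Import Order.TTheory GRing.Theory Num.Theory.

Local Open Scope ring_scope.
Local Open Scope complex_scope.

(** Laplace expansion along column i: deleting that column removes the only change, so the cofactors
    are those of [A]. *)
Lemma det_replace_col (R : comNzRingType) (n : nat) (A : 'M[R]_n)
    (u : 'cV[R]_n) (i : 'I_n) :
  \det (\matrix_(k, j) if j == i then u k 0 else A k j) = (\adj A *m u) i 0.
Proof.
rewrite (expand_det_col _ i) mxE; apply: eq_bigr => k _.
rewrite !mxE eqxx mulrC /cofactor; congr (_ * \det _ * _).
by apply/matrixP => a b; rewrite !mxE eq_sym (negbTE (neq_lift _ _)).
Qed.

Lemma sum_det_replace_col (R : comNzRingType) (n : nat) (A : 'M[R]_n.+1)
    (u : 'cV[R]_n.+1) :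
  (forall j, A 0 j = 1) ->
  \sum_(i < n.+1) \det (\matrix_(k, j) if j == i then u k 0 else A k j)
    = \det A * u 0 0.
Proof.
move=> A1; under eq_bigr do rewrite det_replace_col.
transitivity ((A *m (\adj A *m u)) 0 0).
  by rewrite [RHS]mxE; apply: eq_bigr => i _; rewrite A1 mul1r.
by rewrite mulmxA mul_mx_adj mul_scalar_mx mxE.
Qed.

Section VandermondeMetric.

Variables (R : realType) (n : nat).
Implicit Types z : {ffun 'I_n -> R[i]}.

(** For n = 0 the determinant is 1 while the sum is empty, hence the assumption on n. *)
Lemma vandermonde_det_replace z (y : R[i]) : (0 < n)%N ->
  vandermonde_det z = \sum_(i < n) vandermonde_det (replace_coord z i y).
Proof.
case: n z => // m z _; rewrite /vandermonde_det.
rewrite -[LHS]mulr1 -(_ : (\col_(k < m.+1) y ^+ k) 0 0 = 1); last by rewrite mxE.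
rewrite -sum_det_replace_col => [|j]; last by rewrite !mxE.
apply: eq_bigr => i _; congr (\det _); apply/matrixP => k j.
by rewrite !mxE ffunE; case: eqP.
Qed.

Lemma normc_prod (I : Type) (r : seq I) (P : pred I) (F : I -> R[i]) :
  Normc.normc (\prod_(i <- r | P i) F i)
    = \prod_(i <- r | P i) Normc.normc (F i).
Proof. exact: (big_morph _ (@Normc.normcM R) (@Normc.normc1 R)). Qed.

Lemma normc_sum (I : Type) (r : seq I) (P : pred I) (F : I -> R[i]) :
  Normc.normc (\sum_(i <- r | P i) F i)
    <= \sum_(i <- r | P i) Normc.normc (F i).
Proof.
elim/big_rec2: _ => [|i x y _ le_yx]; first by rewrite Normc.normc0.
by rewrite (le_trans (le_normcD _ _)) ?lerD2l.
Qed.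

Lemma dV_vandermonde_det z : dV z = Normc.normc (vandermonde_det z).
Proof.
rewrite /vandermonde_det det_Vandermonde normc_prod.
under [RHS]eq_bigr do rewrite normc_prod.
(* [det_Vandermonde] has the smaller index in the outer product, [dV] the larger one. *)
rewrite /dV (exchange_big_dep xpredT) //=.
by apply: eq_bigr => i _; apply: eq_bigr => j _; rewrite !mxE.
Qed.

(** A permutation of the points permutes the columns, so the determinant changes at most by a sign,
    which has modulus 1. *)
Lemma dV_perm z (s : 'S_n) : dV [ffun i => z (s i)] = dV z.
Proof.
rewrite !dV_vandermonde_det /vandermonde_det.
set A := Vandermonde n (\row_j z j).
have -> : Vandermonde n (\row_j [ffun i => z (s i)] j) = col_perm s A.
  by apply/matrixP => i j; rewrite !mxE ffunE.
rewrite col_permE det_mulmx det_perm Normc.normcM.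
by case: (odd_perm _); rewrite ?expr0 ?expr1 ?normcN Normc.normc1 mulr1.
Qed.

Lemma dV_eq0 z : dV z = 0 <-> exists i j : 'I_n, i != j /\ z i = z j.
Proof.
rewrite /dV; split => [/eqP/prodf_eq0[i _ /prodf_eq0[j ltji /eqP]]|].
  move/Normc.eq0_normc/subr0_eq => zij; exists i, j; split=> //.
  by rewrite -val_eqE gtn_eqF.
(* Each unordered pair contributes a single factor, so a coincidence has to be read with the larger
   index first. *)
have lt_case (i j : 'I_n) : (j < i)%N -> z i = z j -> dV z = 0.
  move=> ltji zij; rewrite /dV (bigD1 i) //= (bigD1 j) //=.
  by rewrite zij subrr Normc.normc0 !mul0r.
move=> [i [j [neq_ij zij]]]; case: (ltngtP i j) => [lt|lt|/val_inj eq_ij].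
- exact: lt_case lt (esym zij).
- exact: lt_case lt zij.
- by rewrite eq_ij eqxx in neq_ij.
Qed.

Lemma nmetric_dV : (0 < n)%N -> nmetric (fun z => dV z).
Proof.
move=> n_gt0; split=> [|z /dV_eq0 //]; split=> [z i j neq_ij zij|z s|z y].
- by apply/dV_eq0; exists i, j.
- exact: dV_perm.
- rewrite dV_vandermonde_det (vandermonde_det_replace z y n_gt0).
  under [leRHS]eq_bigr do rewrite dV_vandermonde_det.
  exact: normc_sum.
Qed.

End VandermondeMetric.

(** Serves to restrict from [R[i]] to the reals along the embedding. Injectivity is what carries
    definiteness over to [Y]. *)
Lemma nmetric_comp_inj (R : realType) (n : nat) (X Y : Type) (f : Y -> X)
    (d : {ffun 'I_n -> X} -> R) :
  injective f -> nmetric d ->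
  nmetric (fun y : {ffun 'I_n -> Y} => d [ffun i => f (y i)]).
Proof.
move=> f_inj [[d0 dS dT] d_def]; split=> [|x /d_def[i [j [neq_ij]]]]; last first.
  by rewrite !ffunE => /f_inj xij; exists i, j.
split=> [x i j neq_ij xij|x s|x y].
- by apply: (d0 _ _ _ neq_ij); rewrite !ffunE xij.
- by rewrite -[RHS](dS _ s); congr d; apply/ffunP => i; rewrite !ffunE.
- apply: le_trans (dT _ (f y)) _; apply: ler_sum => i _.
  rewrite (_ : replace_coord _ _ _ = [ffun j => f (replace_coord x i y j)]) //.
  by apply/ffunP => j; rewrite !ffunE; case: eqP.
Qed.

Theorem theorem1 (R : realType) (n : nat) (hn : (2 <= n)%N) :
  (forall z : {ffun 'I_n -> R[i]},
     dV z = Normc.normc (vandermonde_det z)) /\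
  nmetric (fun z : {ffun 'I_n -> R[i]} => dV z) /\
  nmetric (fun x : {ffun 'I_n -> R} => dV_real x).
Proof.
have dV_nmetric := nmetric_dV R (ltnW hn).
split; first exact: dV_vandermonde_det.
by split=> //; apply: nmetric_comp_inj dV_nmetric; apply: complexI.
Qed.
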